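(* Let $n\geq 3$ be an odd integer. If $F_n$ is the flower snark on $n$ building blocks, then $\tau(F_n)=2n+1$.
   Context: All graphs are simple, finite and undirected. $\tau(G)$ denotes the vertex cover number of $G$, i.e., the minimum cardinality of a set $C\subseteq V(G)$ such that every edge of $G$ has at least one endpoint in $C$. For odd $n\ge 3$, the flower snark $F_n$ is the graph with vertex set $\bigcup_{j=1}^{n}\{x_j,y_j,v_j,u_j\}$ ($4n$ distinct vertices) and edge set $$\left(\bigcup_{j=1}^{n}\{x_jv_j,\,y_jv_j,\,u_jv_j\}\right)\cup\left(\bigcup_{k=1}^{n-1}\{u_ku_{k+1},\,x_kx_{k+1},\,y_ky_{k+1}\}\right)\cup\{y_1x_n,\,x_1y_n,\,u_1u_n\}.$$ The subgraph on $\{x_j,y_j,v_j,u_j\}$ with edges $x_jv_j,y_jv_j,u_jv_j$ is called the $j$-th building block. *)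

(* Defs.v *)
From HB Require Import structures.
From mathcomp Require Import all_boot.

Set Implicit Arguments.
Unset Strict Implicit.
Unset Printing Implicit Defensive.

Record sgraph := SGraph {
  vertex :> finType;
  adj : rel vertex;
  adj_sym : symmetric adj;
  adj_irr : irreflexive adj
}.

Definition vertex_cover (G : sgraph) (C : {set G}) : bool :=
  [forall p : G, forall q : G, adj p q ==> (p \in C) || (q \in C)].

(* The default [set: G] is always a vertex cover (see vertex_coverT), so that
   the arg min is a genuine minimizer. *)
Definition tau (G : sgraph) : nat :=
  #|[arg min_(C < [set: G] | vertex_cover C) #|C| ]|.

Lemma vertex_coverT (G : sgraph) : vertex_cover [set: G].
Proof. by apply/forallP=> p; apply/forallP=> q; rewrite !inE implybT. Qed.

Inductive letter := Lx | Ly | Lv | Lu.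

Definition letter_code (a : letter) : 'I_4 :=
  match a with
  | Lx => inord 0 | Ly => inord 1 | Lv => inord 2 | Lu => inord 3
  end.

Definition letter_decode (i : 'I_4) : letter :=
  match val i with 0 => Lx | 1 => Ly | 2 => Lv | _ => Lu end.

Lemma letter_codeK : cancel letter_code letter_decode.
Proof. by case; rewrite /letter_decode /= inordK. Qed.

HB.instance Definition _ := Finite.copy letter (can_type letter_codeK).

(* The vertices x_j, y_j, v_j, u_j, for j = 1, ..., n, are the pairs (Lx, i),
   (Ly, i), (Lv, i), (Lu, i) with i = j - 1 : 'I_n. *)
Definition snark_vertex (n : nat) : finType := (letter * 'I_n)%type.

(* Each edge, in one orientation: in wrap-around edges such as y_1 x_n the
   endpoint of index 1 comes first. *)
Definition snark_arc (n : nat) : rel (snark_vertex n) := fun p q =>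
  let: (a, i) := p in
  let: (b, j) := q in
  match a, b with
  | Lx, Lv | Ly, Lv | Lu, Lv => i == j
  | Lx, Lx | Ly, Ly => i.+1 == j
  | Lu, Lu => (i.+1 == j) || (i == 0 :> nat) && (j.+1 == n)
  | Ly, Lx | Lx, Ly => (i == 0 :> nat) && (j.+1 == n)
  | _, _ => false
  end.

Definition snark_adj (n : nat) : rel (snark_vertex n) :=
  fun p q => snark_arc p q || snark_arc q p.

Lemma snark_adj_sym n : symmetric (@snark_adj n).
Proof. by move=> p q; rewrite /snark_adj orbC. Qed.

Lemma snark_adj_irr n : 3 <= n -> irreflexive (@snark_adj n).
Proof.
move=> n_ge3 [a i]; rewrite /snark_adj orbb.
case: a => //=; rewrite (gtn_eqF (ltnSn i)) //=.
by apply/andP=> -[/eqP-> /eqP n1]; move: n_ge3; rewrite -n1.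
Qed.

Definition flower_snark (n : nat) (n_ge3 : 3 <= n) : sgraph :=
  SGraph (@snark_adj_sym n) (snark_adj_irr n_ge3).

(* Main.v *)
Require Import Defs.
From mathcomp Require Import all_boot zify.

Set Implicit Arguments.
Unset Strict Implicit.
Unset Printing Implicit Defensive.

(** The vertices of the flower snark fall into three edge-disjoint kinds of
    subgraphs: the cycle of the [u_j], which has the odd length [n]; the
    cycle of length [2n] through all the [x_j] and [y_j]; and the [n] stars
    centred at the [v_j].

    Lower bound.  Let [U], [W], [V] be the numbers of [u]'s, of [x]'s and
    [y]'s together, and of [v]'s in a vertex cover.  Adding up over the edges
    of each subgraph the number of endpoints in the cover (at least one per
    edge) gives
      [2U >= n],  [2W >= 2n],  [3V + W + U >= 3n].
    As [n] is odd, the first one improves to [2U >= n + 1], and the sum of the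
    three is [3(V + W + U) >= 6n + 1], that is, at least [2n + 1] vertices.
    The two cycle bounds are both instances of [cyclic_sum_bound], and
    [card_by_blocks] splits a cardinal according to the letters.

    Upper bound.  Take alternately the three leaves and the centre of the
    successive stars, beginning with leaves ([alternating_cover]).  An edge
    joining two blocks joins leaves, and one of the blocks is a leaf block:
    this holds also of the edges that close the cycles, since they meet the
    initial block.  With [n] odd there is one more leaf block than there are
    centre blocks, so the cover has [2n + 1] vertices. *)

Lemma sum_letter (F : letter -> nat) :
  \sum_(a : letter) F a = F Lx + F Ly + F Lv + F Lu.
Proof.
have decodeK : cancel letter_decode letter_code.
  by case=> [[|[|[|[|k]]]] lt_k4] //=; apply: val_inj; rewrite /= inordK.
rewrite (reindex letter_decode) /=; last first.
  by exists letter_code => a _; [apply: decodeK | apply: letter_codeK].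
by rewrite !big_ord_recr big_ord0.
Qed.

Lemma card_by_blocks n (C : {set snark_vertex n}) :
  #|C| = \sum_(i < n) (((Lx, i) \in C) + ((Ly, i) \in C)
                       + ((Lv, i) \in C) + ((Lu, i) \in C)).
Proof.
rewrite -sum1_card big_mkcond /=.
rewrite -(eq_bigr _ (fun i _ => sum_letter (fun a => ((a, i) \in C) : nat))).
rewrite exchange_big pair_bigA /=.
by apply: eq_bigr => -[a i] _ /=; case: ifP.
Qed.

(** Each value of [f] occurs in exactly two of the [n] sums of cyclically
    consecutive values. *)
Lemma cyclic_sum_bound n c (f : 'I_n -> nat) :
  (forall i, c <= f i + f (ordS i)) -> n * c <= 2 * \sum_(i < n) f i.
Proof.
move=> le_c; rewrite mul2n -addnn.
rewrite {2}(reindex_inj (@ordS_inj n)) -big_split /=.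
by rewrite -[X in X * c]card_ord -sum_nat_const; apply: leq_sum.
Qed.

Lemma ordS_cases n (i : 'I_n) :
  ordS i = i.+1 :> nat \/ ordS i = 0 :> nat /\ i.+1 = n.
Proof.
rewrite /=; have [lt_i1|] := ltnP i.+1 n; first by left; rewrite modn_small.
move=> le_n; right; have -> : i.+1 = n by apply/eqP; rewrite eqn_leq ltn_ord.
by rewrite modnn.
Qed.

Lemma cover_lower_bound n (C : {set snark_vertex n}) :
    odd n -> (forall p q, snark_arc p q -> (p \in C) || (q \in C)) ->
  2 * n + 1 <= #|C|.
Proof.
move=> n_odd covC; rewrite card_by_blocks !big_split /=.
have u_cycle : n * 1 <= 2 * \sum_(i < n) ((Lu, i) \in C).
  apply: cyclic_sum_bound => i; case: (ordS_cases i) => [Si | [Si i_last]].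
    have := covC (Lu, i) (Lu, ordS i); rewrite /snark_arc Si eqxx.
    by move/(_ isT); do 2!case: (_ \in C).
  have := covC (Lu, ordS i) (Lu, i); rewrite /snark_arc Si i_last !eqxx orbT.
  by move/(_ isT); do 2!case: (_ \in C).
(* Closing the cycle exchanges the letters x and y, which does not affect the
   number of endpoints in the pair x_i, y_i; so the long cycle is handled as
   a cycle of [n] pairs of edges. *)
have xy_cycle : n * 2 <=
    2 * \sum_(i < n) (((Lx, i) \in C) + ((Ly, i) \in C)).
  apply: cyclic_sum_bound => i; case: (ordS_cases i) => [Si | [Si i_last]].
    have := covC (Lx, i) (Lx, ordS i); have := covC (Ly, i) (Ly, ordS i).
    rewrite /snark_arc Si eqxx => /(_ isT) + /(_ isT).
    by do 4!case: (_ \in C).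
  have := covC (Lx, ordS i) (Ly, i); have := covC (Ly, ordS i) (Lx, i).
  rewrite /snark_arc Si i_last !eqxx => /(_ isT) + /(_ isT).
  by do 4!case: (_ \in C).
have stars : n * 3 <= \sum_(i < n) (3 * ((Lv, i) \in C)
    + (((Lx, i) \in C) + ((Ly, i) \in C)) + ((Lu, i) \in C)).
  rewrite -[X in X * 3]card_ord -sum_nat_const; apply: leq_sum => i _.
  have := covC (Lx, i) (Lv, i); have := covC (Ly, i) (Lv, i).
  have := covC (Lu, i) (Lv, i).
  rewrite /snark_arc eqxx => /(_ isT) + /(_ isT) + /(_ isT).
  by do 4!case: (_ \in C).
rewrite big_split /= in xy_cycle.
rewrite !big_split big1_eq /= in stars.
move: u_cycle xy_cycle stars.
move: (\sum_(i < n) ((Lu, i) \in C)) (\sum_(i < n) ((Lv, i) \in C)).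
move: (\sum_(i < n) ((Lx, i) \in C)) (\sum_(i < n) ((Ly, i) \in C)).
by move=> x y u v; lia.
Qed.

Definition alternating_cover n : {set snark_vertex n} :=
  [set p : letter * 'I_n | if p.1 is Lv then odd p.2 else ~~ odd p.2].

Lemma alternating_coverP n (p q : snark_vertex n) :
  snark_arc p q -> (p \in alternating_cover n) || (q \in alternating_cover n).
Proof.
case: p q => [[] i] [[] j] //=; rewrite !inE /=;
  by [move/eqP<-; rewrite /= ?negbK; case: (odd i)
     | case/andP=> /eqP->
     | case/orP=> [/eqP<- | /andP[/eqP->]] //; rewrite /= negbK; case: (odd i)].
Qed.

Lemma card_alternating_cover n : #|alternating_cover n| = 2 * n + odd n.
Proof.
rewrite card_by_blocks.
under eq_bigr => i _ do rewrite !inE /=.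
by elim: n => [|n IHn]; rewrite ?big_ord0 // big_ord_recr /= IHn; lia.
Qed.

Theorem theorem14 (n : nat) (n_ge3 : 3 <= n) (n_odd : odd n) :
  tau (flower_snark n_ge3) = 2 * n + 1.
Proof.
rewrite /tau; case: arg_minnP => [|C covC minC]; first exact: vertex_coverT.
apply/eqP; rewrite eqn_leq; apply/andP; split.
  have := card_alternating_cover n; rewrite n_odd => <-; apply: minC.
  apply/forallP=> p; apply/forallP=> q.
  apply/implyP=> /orP[] /alternating_coverP //.
  by rewrite orbC.
apply: cover_lower_bound => // p q arc_pq.
have /forallP/(_ p)/forallP/(_ q)/implyP := covC; apply.
by rewrite /= /snark_adj arc_pq.
Qed.
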